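(* Let $X$ be the Kodaira–Thurston manifold and, for $a\in\mathbb R\setminus\{0\}$ with $a^2<1$, let $J_a$ be the almost-complex structure on $X$ for which $$\Phi^1_a=(e^1+a e^4)+i e^3,\qquad \Phi^2_a=e^2+i e^4$$ is a global coframe of $(1,0)$-forms. Then $(X,J_a)$ admits both almost-Kähler metrics and (strictly) locally conformally Kähler metrics.
   Context: Let $\mathbb H_3(\mathbb R)$ be the $3$-dimensional Heisenberg group of real matrices $\begin{bmatrix}1&x_1&x_3\\0&1&x_2\\0&0&1\end{bmatrix}$ and $\Gamma$ its subgroup of matrices with integer entries. The Kodaira–Thurston manifold is the compact $4$-manifold $X=\frac{\mathbb H_3(\mathbb R)}{\Gamma}\times\mathbb S^1$ (the quotient by left multiplication by $\Gamma$). With $x_4$ the coordinate on $\mathbb S^1$, a global coframe on $X$ is given by $$e^1=dx_1,\quad e^2=dx_2,\quad e^3=dx_3-x_1dx_2,\quad e^4=dx_4,$$ with $de^1=de^2=de^4=0$ and $de^3=-e^1\wedge e^2$. A Hermitian metric on $(X,J)$ is a $J$-invariant Riemannian metric $g$, identified with its fundamental $(1,1)$-form $\omega(\cdot,\cdot)=g(J\cdot,\cdot)$. It is almost-Kähler if $d\omega=0$, and (strictly) locally conformally Kähler if $d\omega=\alpha\wedge\omega$ for a $1$-form $\alpha$ that is $d$-closed but not $d$-exact. *)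

(* Defs.v *)
From mathcomp Require Import all_boot all_order all_algebra.
From mathcomp Require Import all_classical all_reals all_analysis.
From mathcomp Require Import complex.

Set Implicit Arguments.
Unset Strict Implicit.
Unset Printing Implicit Defensive.

Import Order.TTheory GRing.Theory Num.Theory.
Import numFieldNormedType.Exports.

Local Open Scope ring_scope.

(* The Kodaira-Thurston manifold X = Gamma \ H_3(R) x R/Z is the quotient of
   its universal cover H_3(R) x R, with global coordinates
   (x_1, x_2, x_3, x_4) : 'rV_4, by a group acting smoothly, freely and properly
   discontinuously. A tensor field on X is therefore a tensor field on 'rV_4
   that is invariant under this group.  The coordinates x_1, ..., x_4 are
   x 0 0, ..., x 0 3, and tangent vectors are row vectors. *)

Definition in_heisenberg {R : realType} (M : 'M[R]_3) : Prop :=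
  forall i j : 'I_3, (j <= i)%N -> M i j = (i == j)%:R.

Definition in_Gamma {R : realType} (M : 'M[R]_3) : Prop :=
  in_heisenberg M /\ (forall i j, M i j \is a Num.int).

Definition heis {R : realType} (x : 'rV[R]_4) : 'M[R]_3 :=
  1%:M + x 0 0 *: delta_mx 0 1 + x 0 1 *: delta_mx 1 2%:R
       + x 0 2%:R *: delta_mx 0 2%:R.

Definition heis_coord {R : realType} (M : 'M[R]_3) (t : R) : 'rV[R]_4 :=
  \row_j [:: M 0 1; M 1 2%:R; M 0 2%:R; t]`_j.

(* (h, t) |-> (gamma h, t + m) on H_3(R) x R, read in coordinates. *)
Definition deck {R : realType} (gamma : 'M[R]_3) (m : R) (x : 'rV[R]_4) :
    'rV[R]_4 :=
  heis_coord (gamma *m heis x) (x 0 3%:R + m).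

Definition Ck_step {R : realType} (P : ('rV[R]_4 -> R) -> Prop)
    (f : 'rV[R]_4 -> R) : Prop :=
  forall j : 'I_4, (forall x, derivable f x (delta_mx 0 j)) /\
                   P (fun x => 'D_(delta_mx 0 j) f x).

Fixpoint Ck {R : realType} (n : nat) (f : 'rV[R]_4 -> R) : Prop :=
  if n is n'.+1 then continuous f /\ Ck_step (Ck n') f else continuous f.

Definition smooth {R : realType} (f : 'rV[R]_4 -> R) : Prop :=
  forall n, Ck n f.

(* Covariant k-tensor fields: t x V is the value at x on the k rows of V. *)
Definition field (R : realType) (k : nat) : Type :=
  'rV[R]_4 -> 'M[R]_(k, 4) -> R.

Definition set_row {R : realType} {k : nat} (V : 'M[R]_(k, 4)) (i : 'I_k)
    (v : 'rV[R]_4) : 'M[R]_(k, 4) :=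
  \matrix_(r, j) if r == i then v 0 j else V r j.

Definition multilinear {R : realType} {k : nat} (t : field R k) : Prop :=
  forall (x : 'rV[R]_4) (V : 'M[R]_(k, 4)) (i : 'I_k) (c : R)
         (u v : 'rV[R]_4),
    t x (set_row V i (c *: u + v)) =
    c * t x (set_row V i u) + t x (set_row V i v).

Definition pullback {R : realType} {k : nat} (f : 'rV[R]_4 -> 'rV[R]_4)
    (t : field R k) : field R k :=
  fun x V => t (f x) (\matrix_i 'd f x (row i V)).

Definition tensor_field {R : realType} {k : nat} (t : field R k) : Prop :=
  [/\ multilinear t,
      forall V, smooth (t ^~ V) &
      forall gamma m, in_Gamma gamma -> m \is a Num.int ->
        pullback (deck gamma m) t =2 t].

Definition diff_form {R : realType} {k : nat} (w : field R k) : Prop :=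
  tensor_field w /\
  (forall x (V : 'M[R]_(k, 4)) (i j : 'I_k),
     i != j -> row i V = row j V -> w x V = 0).

(* d w (v_0, ..., v_k) = sum_i (-1)^i v_i (w (v_0, ..., ^v_i, ..., v_k)) for
   constant (hence commuting) vector fields v_0, ..., v_k on 'rV_4. *)
Definition ext_d {R : realType} {k : nat} (w : field R k) : field R k.+1 :=
  fun x V =>
    \sum_(i < k.+1) (-1) ^+ i * 'D_(row i V) (fun y => w y (row' i V)) x.

(* Normalised so that (e /\ f)(u, v) = e u * f v - e v * f u for 1-forms. *)
Definition wedge1 {R : realType} {k : nat} (al : field R 1) (w : field R k) :
    field R k.+1 :=
  fun x V => \sum_(i < k.+1) (-1) ^+ i * (al x (row i V) * w x (row' i V)).

Definition d_closed {R : realType} {k : nat} (w : field R k) : Prop :=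
  forall x V, ext_d w x V = 0.

Definition d_exact {R : realType} {k : nat} (w : field R k.+1) : Prop :=
  exists b : field R k, diff_form b /\ ext_d b =2 w.

Definition e1 {R : realType} : field R 1 := fun x v => v 0 0.
Definition e2 {R : realType} : field R 1 := fun x v => v 0 1.
Definition e3 {R : realType} : field R 1 :=
  fun x v => v 0 2%:R - x 0 0 * v 0 1.
Definition e4 {R : realType} : field R 1 := fun x v => v 0 3%:R.

(* J x maps the tangent vector v at x to v *m J x. *)
Definition almost_complex {R : realType} (J : 'rV[R]_4 -> 'M[R]_4) : Prop :=
  [/\ forall i j, smooth (fun x => J x i j),
      forall gamma m, in_Gamma gamma -> m \is a Num.int ->
        forall x v, 'd (deck gamma m) x (v *m J x) =
                    'd (deck gamma m) x v *m J (deck gamma m x) &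
      forall x, J x *m J x = - 1%:M].

Local Open Scope complex_scope.

Definition cfield1 (R : realType) : Type := 'rV[R]_4 -> 'rV[R]_4 -> R[i].

Definition complex_form1 {R : realType} (phi : cfield1 R) : Prop :=
  diff_form (fun x (v : 'M[R]_(1, 4)) => complex.Re (phi x v)) /\
  diff_form (fun x (v : 'M[R]_(1, 4)) => complex.Im (phi x v)).

Definition covector10 {R : realType} (Jx : 'M[R]_4) (l : 'rV[R]_4 -> R[i]) :
    Prop :=
  (forall c u v, l (c *: u + v) = c%:C * l u + l v) /\
  (forall v, l (v *m Jx) = 'i * l v).

(* phi1 and phi2 are (1,0)-forms and a basis of the (1,0)-covectors at each
   point. *)
Definition coframe10 {R : realType} (J : 'rV[R]_4 -> 'M[R]_4)
    (phi1 phi2 : cfield1 R) : Prop :=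
  [/\ complex_form1 phi1,
      complex_form1 phi2 &
      forall x,
        [/\ covector10 (J x) (phi1 x),
            covector10 (J x) (phi2 x) &
            forall l, covector10 (J x) l ->
              exists! c : R[i] * R[i],
                forall v, l v = c.1 * phi1 x v + c.2 * phi2 x v]].

Definition Phi1 {R : realType} (a : R) : cfield1 R :=
  fun x v => (e1 x v + a * e4 x v) +i* e3 x v.
Definition Phi2 {R : realType} : cfield1 R :=
  fun x v => e2 x v +i* e4 x v.

Local Close Scope complex_scope.

Definition riemannian {R : realType} (g : field R 2) : Prop :=
  [/\ tensor_field g,
      forall x (u v : 'rV[R]_4), g x (col_mx u v) = g x (col_mx v u) &
      forall x (v : 'rV[R]_4), v != 0 -> 0 < g x (col_mx v v)].

Definition hermitian {R : realType} (J : 'rV[R]_4 -> 'M[R]_4) (g : field R 2) :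
    Prop :=
  riemannian g /\ (forall x V, g x (V *m J x) = g x V).

Definition fundamental_form {R : realType} (J : 'rV[R]_4 -> 'M[R]_4)
    (g : field R 2) : field R 2 :=
  fun x V => g x (col_mx (row 0 V *m J x) (row 1 V)).

Definition almost_kahler {R : realType} (J : 'rV[R]_4 -> 'M[R]_4)
    (g : field R 2) : Prop :=
  hermitian J g /\ d_closed (fundamental_form J g).

Definition strictly_lck {R : realType} (J : 'rV[R]_4 -> 'M[R]_4)
    (g : field R 2) : Prop :=
  hermitian J g /\
  exists al : field R 1,
    [/\ diff_form al, d_closed al, ~ d_exact al &
        ext_d (fundamental_form J g) =2 wedge1 al (fundamental_form J g)].

(* Main.v *)
(* For any b, the (1,0)-forms Phi1 a + i (a - b) Phi2 = theta1 + i theta2 and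
   Phi2 = e2 + i e4 span the same space as Phi1 a and Phi2, so the sum of the
   squares of theta1 = e1 + b e4, theta2 = e3 + (a - b) e2, e2 and e4 is a
   Hermitian metric.  Its fundamental form w = theta1 /\ theta2 + e2 /\ e4
   satisfies d w = b e1 /\ e2 /\ e4 = (b theta1) /\ w.  Hence b = 0 gives an
   almost-Kaehler metric, while b = a <> 0 gives a locally conformally Kaehler
   one whose Lee form a theta1 is closed, but not exact because its integral
   over the S^1 factor is a^2. *)
Require Import Defs.
From mathcomp Require Import all_boot all_order all_algebra.
From mathcomp Require Import all_classical all_reals all_analysis.
From mathcomp Require Import complex ring.

Import Order.TTheory GRing.Theory Num.Theory.
Import numFieldNormedType.Exports.
Local Open Scope ring_scope.

(** * Closure properties of smooth functions *)

Lemma Ck_cst (R : realType) n (c : R) : Ck n (fun=> c).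
Proof.
elim: n c => [|n IH] c; first exact: cst_continuous.
split; first exact: cst_continuous.
move=> j; split=> [x|]; first exact: derivable_cst.
have -> : (fun x : 'rV[R]_4 => 'D_(delta_mx 0 j) (fun=> c) x) = fun=> 0.
  by apply/funext => x; rewrite derive_cst.
exact: IH.
Qed.

(** In the Leibniz rule the undifferentiated factors have class [n.+1] and the derivatives class
    [n]; this brings them to a common order. *)
Lemma Ck_leS (R : realType) n (f : 'rV[R]_4 -> R) : Ck n.+1 f -> Ck n f.
Proof.
elim: n f => [|n IH] f [cf Df]; first exact: cf.
by split=> // j; have [df /IH] := Df j.
Qed.

Lemma CkD (R : realType) n (f g : 'rV[R]_4 -> R) :
  Ck n f -> Ck n g -> Ck n (fun x => f x + g x).
Proof.
elim: n f g => [|n IH] f g.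
  by move=> cf cg x; exact: (cvgD (cf x) (cg x)).
move=> [cf Df] [cg Dg]; split.
  by move=> x; exact: (cvgD (cf x) (cg x)).
move=> j; have [df Cf] := Df j; have [dg Cg] := Dg j; split.
  by move=> x; apply: derivableD.
have -> : (fun x : 'rV[R]_4 => 'D_(delta_mx 0 j) (fun y => f y + g y) x) =
    fun x => 'D_(delta_mx 0 j) f x + 'D_(delta_mx 0 j) g x.
  by apply/funext => x; rewrite -deriveD.
exact: IH.
Qed.

Lemma CkM (R : realType) n (f g : 'rV[R]_4 -> R) :
  Ck n f -> Ck n g -> Ck n (fun x => f x * g x).
Proof.
elim: n f g => [|n IH] f g.
  by move=> cf cg x; exact: (cvgM (cf x) (cg x)).
move=> Cf1 Cg1; have [cf Df] := Cf1; have [cg Dg] := Cg1; split.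
  by move=> x; exact: (cvgM (cf x) (cg x)).
move=> j; have [df Cf] := Df j; have [dg Cg] := Dg j; split.
  by move=> x; apply: derivableM.
have -> : (fun x : 'rV[R]_4 => 'D_(delta_mx 0 j) (fun y => f y * g y) x) =
    fun x => f x * 'D_(delta_mx 0 j) g x + g x * 'D_(delta_mx 0 j) f x.
  by apply/funext => x; rewrite -[LHS]/('D_(delta_mx 0 j) (f * g) x) deriveM.
by apply: CkD; apply: IH => //; apply: Ck_leS.
Qed.

(** * Algebra of invariant tensor fields *)

Section TensorFields.
Context {R : realType}.
Implicit Types (x : 'rV[R]_4) (th : field R 1).

Lemma row_set_row k (V : 'M[R]_(k, 4)) (i r : 'I_k) (w : 'rV[R]_4) :
  row r (set_row V i w) = if r == i then w else row r V.
Proof. by apply/rowP => j; rewrite !mxE; case: eqP => // _; rewrite mxE. Qed.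

Lemma row_row (V : 'rV[R]_4) (i : 'I_1) : row i V = V.
Proof. by apply/rowP => j; rewrite mxE (ord1 i). Qed.

Lemma row0_col_mx (u v : 'rV[R]_4) : row (0 : 'I_2) (col_mx u v) = u.
Proof.
by apply/rowP => j; rewrite !mxE; case: splitP => // k; rewrite (ord1 k).
Qed.

Lemma row1_col_mx (u v : 'rV[R]_4) : row (1 : 'I_2) (col_mx u v) = v.
Proof.
by apply/rowP => j; rewrite !mxE; case: splitP => k; rewrite (ord1 k).
Qed.

(** With a single row, [set_row] overwrites the whole matrix, so linearity in the slot is plain
    linearity. *)
Lemma multilinear_linear th : multilinear th ->
  forall x c (u v : 'rV[R]_4), th x (c *: u + v) = c * th x u + th x v.
Proof.
have set_row1 (w : 'rV[R]_4) : set_row (0 : 'rV[R]_4) 0 w = w.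
  by rewrite -[LHS](row_row _ 0) row_set_row eqxx.
by move=> th_lin x c u v; have := th_lin x 0 0 c u v; rewrite !set_row1.
Qed.

Lemma pullback1 (f : 'rV[R]_4 -> 'rV[R]_4) th x (v : 'rV[R]_4) :
  pullback f th x v = th (f x) ('d f x v).
Proof.
rewrite /pullback; congr (th _ _).
by rewrite -[LHS](row_row _ 0) rowK row_row.
Qed.

Lemma tensor_fieldD {k} {s t : field R k} : tensor_field s -> tensor_field t ->
  tensor_field (fun x V => s x V + t x V).
Proof.
move=> [ls ss ps] [lt st pt]; split.
- by move=> x V i c u v; rewrite ls lt; ring.
- by move=> V n; apply: CkD; [apply: ss|apply: st].
- move=> gamma m hg hm x V; rewrite -[in RHS](ps gamma m) //.
  by rewrite -[in RHS](pt gamma m).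
Qed.

Lemma tensor_fieldZ {k} (c : R) {t : field R k} : tensor_field t ->
  tensor_field (fun x V => c * t x V).
Proof.
move=> [lt st pt]; split.
- by move=> x V i d u v; rewrite lt; ring.
- by move=> V n; apply: CkM; [apply: Ck_cst|apply: st].
- by move=> gamma m hg hm x V; rewrite -[in RHS](pt gamma m).
Qed.

Definition tensor_sq th : field R 2 :=
  fun x V => th x (row 0 V) * th x (row 1 V).

Lemma tensor_field_sq th : tensor_field th -> tensor_field (tensor_sq th).
Proof.
move=> [/multilinear_linear lt st pt]; split.
- move=> x V i c u v; rewrite /tensor_sq !row_set_row.
  by case: i => [[|[|//]] ?]; rewrite /= lt; ring.
- by move=> V n; apply: CkM; apply: st.
- move=> gamma m hg hm x V; rewrite /pullback /tensor_sq !rowK.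
  by rewrite -!pullback1 !pt.
Qed.

(** Alternation is vacuous in degree one: there are no two distinct row indices. *)
Lemma diff_form1 th : tensor_field th -> diff_form th.
Proof. by split=> // x V i j; rewrite !ord1. Qed.

End TensorFields.

(** * Derivatives along lines, translation in [x_4], affine functions *)

Lemma is_derive_line (R : realType) (V : normedModType R) (f : V -> R) (v : V)
    (c t : R) :
  is_derive (t *: v) v f c -> is_derive t 1 (fun s => f (s *: v)) c.
Proof.
have E : (fun h : R => h^-1 *: (f ((h *: 1 + t) *: v) - f (t *: v))) =
         (fun h : R => h^-1 *: (f (h *: v + t *: v) - f (t *: v))).
  by apply/funext => h; rewrite scalerDl /GRing.scale /= mulr1.
move=> [df dfE]; split; first by rewrite /derivable E.
by rewrite -dfE /derive E.
Qed.

(** By the mean value theorem on the segment from 0 to [v], [c] equals [f v - f 0]. This stands in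
    for integration over the circle factor. *)
Lemma derive_cst_period (R : realType) (V : normedModType R) (f : V -> R)
    (v : V) (c : R) :
  (forall x, is_derive x v f c) -> f v = f 0 -> c = 0.
Proof.
move=> df fv.
have dg (t : R) : is_derive t (1 : R) (fun s : R => f (s *: v)) c.
  exact: is_derive_line.
have [|t _] := MVT (@ltr01 R) (fun t _ => dg t).
  apply: derivable_within_continuous => t _.
  exact: (@ex_derive _ _ _ _ _ _ _ (dg t)).
by rewrite scale1r scale0r fv subrr subr0 mulr1.
Qed.

(** For [m = 1] this is the deck transformation going once around the circle factor. *)
Lemma deck1E (R : realType) (m : R) x :
  deck (1%:M : 'M[R]_3) m x = x + m *: delta_mx 0 3%:R.
Proof.
rewrite /deck mul1mx; apply/rowP => j; rewrite !mxE.
case: j => [[|[|[|[|//]]]] ?]; rewrite /= ?mxE //=;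
  rewrite ?mulr0 ?mulr1 ?addr0 ?add0r; last congr (_ + _);
  by congr (x _ _); exact: val_inj.
Qed.

Lemma derive_affine_coord (R : realType) m n (c d : R) i j
    (x v : 'M[R]_(m.+1, n.+1)) :
  'D_v (fun y : 'M[R]_(m.+1, n.+1) => c + d * y i j) x = d * v i j.
Proof.
have dy : derivable (fun y : 'M[R]_(m.+1, n.+1) => y i j) x v.
  exact/diff_derivable/differentiable_coord.
have dyE : 'D_v (fun y : 'M[R]_(m.+1, n.+1) => y i j) x = v i j.
  by rewrite -[in RHS](derive_id x v) derive_mx ?mxE //; exact: derivable_id.
rewrite -[LHS]/('D_v (cst c + d \*: (fun y : 'M[R]_(m.+1, n.+1) => y i j)) x).
by rewrite deriveD ?deriveZ ?derive_cst ?add0r ?dyE //; exact: derivableZ.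
Qed.

(** * The family of metrics and their fundamental forms *)

Section Metrics.
Context {R : realType} (a b : R).

Definition theta1 : field R 1 := fun x v => e1 x v + b * e4 x v.
Definition theta2 : field R 1 := fun x v => e3 x v + (a - b) * e2 x v.

Definition metric : field R 2 := fun x V =>
  tensor_sq theta1 x V + tensor_sq theta2 x V
  + (tensor_sq e2 x V + tensor_sq e4 x V).

Lemma metric_riemannian :
  tensor_field (@e1 R) -> tensor_field (@e2 R) ->
  tensor_field (@e3 R) -> tensor_field (@e4 R) -> riemannian metric.
Proof.
move=> t1 t2 t3 t4; split.
- have T1 : tensor_field theta1.
    by apply: tensor_fieldD => //; exact: tensor_fieldZ.
  have T2 : tensor_field theta2.
    by apply: tensor_fieldD => //; exact: tensor_fieldZ.
  by do !apply: tensor_fieldD; apply: tensor_field_sq.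
- move=> x u v; rewrite /metric /tensor_sq !row0_col_mx !row1_col_mx; ring.
- move=> x v; rewrite /metric /tensor_sq !row0_col_mx !row1_col_mx -!expr2.
  move=> v0; rewrite lt_neqAle eq_sym !addr_ge0 ?sqr_ge0 // andbT.
  apply: contra v0; rewrite !paddr_eq0 ?addr_ge0 ?sqr_ge0 // !sqrf_eq0.
  rewrite /theta1 /theta2 /e1 /e2 /e3 /e4.
  move=> /andP[/andP[/eqP h1 /eqP h2] /andP[/eqP h3 /eqP h4]].
  (* The system is triangular: [h4] removes the [b] term from [h1], and [h3] removes the [x_1] and
     [a - b] terms from [h2]. *)
  rewrite h4 mulr0 addr0 in h1; rewrite h3 !mulr0 subr0 addr0 in h2.
  apply/eqP/rowP => j; rewrite mxE.
  by case: j => [[|[|[|[|//]]]] ?]; [rewrite -[RHS]h1|rewrite -[RHS]h3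
    |rewrite -[RHS]h2|rewrite -[RHS]h4]; congr (v _ _); exact: val_inj.
Qed.

Section Hermitian.
Context (J : 'rV[R]_4 -> 'M[R]_4)
  (J1 : forall x v, e1 x (v *m J x) + a * e4 x (v *m J x) = - e3 x v)
  (J2 : forall x v, e2 x (v *m J x) = - e4 x v)
  (J3 : forall x v, e3 x (v *m J x) = e1 x v + a * e4 x v)
  (J4 : forall x v, e4 x (v *m J x) = e2 x v).

(** Real part of the (1,0) condition for [theta1] + i [theta2]; [theta2J] is the imaginary part. *)
Lemma theta1J x v : theta1 x (v *m J x) = - theta2 x v.
Proof.
have e1J : e1 x (v *m J x) = - e3 x v - a * e2 x v by rewrite -J1 J4; ring.
by rewrite /theta1 /theta2 e1J J4; ring.
Qed.

Lemma theta2J x v : theta2 x (v *m J x) = theta1 x v.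
Proof. by rewrite /theta1 /theta2 J3 J2; ring. Qed.

(** [J] exchanges [theta1] with [theta2] and [e2] with [e4] up to sign, and each sign occurs
    twice. *)
Lemma metric_hermitian x V : metric x (V *m J x) = metric x V.
Proof.
rewrite /metric /tensor_sq !row_mul !theta1J !theta2J !J2 !J4; ring.
Qed.

Lemma fundamental_formE x V : fundamental_form J metric x V =
  theta1 x (row 0 V) * theta2 x (row 1 V)
  - theta2 x (row 0 V) * theta1 x (row 1 V)
  + (e2 x (row 0 V) * e4 x (row 1 V) - e4 x (row 0 V) * e2 x (row 1 V)).
Proof.
rewrite /fundamental_form /metric /tensor_sq row0_col_mx row1_col_mx.
rewrite !theta1J !theta2J !J2 !J4; ring.
Qed.

(** The base point enters only through the term -x_1 [e2] of [e3], so the coefficient is affine in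
    x_1, with slope minus the value of [theta1] /\ [e2] on [W]. *)
Lemma derive_fundamental_form x v W :
  'D_v (fun y => fundamental_form J metric y W) x =
  (theta1 x (row 1 W) * e2 x (row 0 W) - theta1 x (row 0 W) * e2 x (row 1 W))
  * v 0 0.
Proof.
rewrite -(derive_affine_coord _ _ _ (fundamental_form J metric 0 W) _ _ _ x v).
congr ('D_v _ x); apply/funext => y.
rewrite !fundamental_formE /theta1 /theta2 /e1 /e2 /e3 /e4.
by rewrite [(0 : 'rV[R]_4) 0 0]mxE; ring.
Qed.

Lemma ext_d_fundamental_form :
  ext_d (fundamental_form J metric) =2
  wedge1 (fun x v => b * theta1 x v) (fundamental_form J metric).
Proof.
move=> x V; rewrite /ext_d /wedge1.
under eq_bigr => i _ do rewrite derive_fundamental_form.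
under [RHS]eq_bigr => i _ do rewrite fundamental_formE.
rewrite !big_ord_recl !big_ord0 /theta1 /theta2 /e1 /e2 /e3 /e4 !mxE.
(* Deleting rows leaves nested [lift] indices; once they are numerals, [ring] can match the entries
   of [V]. *)
have -> : lift (lift ord0 (lift ord0 ord0)) 0 = 0 :> 'I_3 by exact: val_inj.
have -> : lift (lift ord0 (lift ord0 ord0)) 1 = 1 :> 'I_3 by exact: val_inj.
have -> : lift (lift ord0 ord0) 0 = 0 :> 'I_3 by exact: val_inj.
have -> : lift (lift ord0 ord0) 1 = 2%:R :> 'I_3 by exact: val_inj.
have -> : lift ord0 0 = 1 :> 'I_3 by exact: val_inj.
have -> : lift ord0 1 = 2%:R :> 'I_3 by exact: val_inj.
have -> : lift ord0 (lift ord0 ord0) = 2%:R :> 'I_3 by exact: val_inj.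
have -> : ord0 = 0 :> 'I_3 by exact: val_inj.
rewrite /= /bump /= !exprS expr0; ring.
Qed.

End Hermitian.
End Metrics.

(** * The Lee form: closed but not exact *)

Lemma d_closed_theta1 (R : realType) (b c : R) :
  d_closed (fun x v => c * theta1 b x v).
Proof.
move=> x V; rewrite /ext_d big1 // => i _.
(* Only dx_1 and dx_4 occur, with constant coefficients, so the base point may be replaced by 0. *)
rewrite -[X in _ * X]/('D_(row i V) (cst (c * theta1 b 0 (row' i V))) x).
by rewrite derive_cst mulr0.
Qed.

(** A primitive would have constant derivative [c * b] along x_4, yet be 1-periodic in x_4 by deck
    invariance. *)
Lemma theta1_not_exact (R : realType) (b c : R) :
  c * b != 0 -> ~ d_exact (fun x v => c * theta1 b x v).
Proof.
move=> /eqP cb0 [f [[[_ sf pf] _] df]]; apply: cb0.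
pose v : 'rV[R]_4 := delta_mx 0 3%:R.
(* A primitive is a 0-form; its matrix argument has no rows, hence is always 0. *)
have row'E (w : 'M[R]_(1, 4)) : row' 0 w = 0 by apply/matrixP => -[].
apply: (@derive_cst_period _ _ (f ^~ 0) v) => [x|].
  have [_ /(_ 3%:R) [fx _]] := sf 0 1%N.
  have <- : 'D_v (f ^~ 0) x = c * b.
    have := df x v; rewrite /ext_d big_ord1 row'E row_row expr0 mul1r => ->.
    by rewrite /theta1 /e1 /e4 !mxE /= add0r mulr1.
  exact: derivableP.
have G1 : in_Gamma (1%:M : 'M[R]_3).
  split=> [i j|i j]; rewrite mxE; last exact: natr_int.
  by [].
(* Invariance at the origin under the unit translation in x_4 gives equal values at [v] and 0. *)
have := pf _ 1 G1 (rpred1 _) 0 0; rewrite /pullback deck1E scale1r add0r.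
by rewrite (_ : \matrix_i _ = 0) //; apply/matrixP => -[].
Qed.

Theorem proposition4p2 (R : realType) (a : R) (J : 'rV[R]_4 -> 'M[R]_4)
    (ha0 : a != 0) (ha1 : a ^+ 2 < 1)
    (hJ : almost_complex J) (hPhi : coframe10 J (Phi1 a) Phi2) :
  (exists g : field R 2, almost_kahler J g) /\
  (exists g : field R 2, strictly_lck J g).
Proof.
have [[[t14 _] [t3 _]] [[t2 _] [t4 _]] h10] := hPhi.
rewrite /= in t14 t3 t2 t4.
have t1 : tensor_field (@e1 R).
  (* [e1] is Re [Phi1 a] minus [a] times Im [Phi2]. *)
  have := tensor_fieldD t14 (tensor_fieldZ (- a) t4).
  congr tensor_field; apply/funext => x; apply/funext => v /=; ring.
(* Real and imaginary parts of the (1,0) condition on [Phi1 a]; the same is then done for [Phi2]. *)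
have [J1 J3] : (forall x v, e1 x (v *m J x) + a * e4 x (v *m J x) = - e3 x v)
    /\ (forall x v, e3 x (v *m J x) = e1 x v + a * e4 x v).
  split=> x v; have [[_ /(_ v)]] := h10 x; rewrite /Phi1 => /eqP;
  by rewrite eq_complex /= !mul0r !mul1r ?add0r ?sub0r => /andP[/eqP ? /eqP ?].
have [J2 J4] : (forall x v, e2 x (v *m J x) = - e4 x v)
    /\ (forall x v, e4 x (v *m J x) = e2 x v).
  split=> x v; have [_ [_ /(_ v)]] := h10 x; rewrite /Phi2 => /eqP;
  by rewrite eq_complex /= !mul0r !mul1r ?add0r ?sub0r => /andP[/eqP ? /eqP ?].
have herm b : Defs.hermitian J (metric a b).
  by split; [exact: metric_riemannian|exact: metric_hermitian].
have dE b := @ext_d_fundamental_form _ a b J J1 J2 J3 J4.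
split.
  exists (metric a 0); split=> // x V.
  by rewrite dE /wedge1 big1 // => i _; rewrite !mul0r mulr0.
exists (metric a a); split=> //.
exists (fun x v => a * theta1 a x v); split=> //.
(* [theta1 a] is by definition the real part of [Phi1 a], so [t14] applies to it. *)
- apply: diff_form1; apply: tensor_fieldZ; exact: t14.
- exact: d_closed_theta1.
- by apply: theta1_not_exact; rewrite mulf_neq0.
Qed.
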